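(* Let $X$ be a real normed space, let $\Omega\subset X$ be a nonempty closed set and let $F\subset X$ be a nonempty closed bounded convex set with $F\ne\{0\}$. Let $\bar x\notin\Omega$ with $r:=T_\Omega^F(\bar x)<\infty$. Then $$\widehat\partial^\infty T_\Omega^F(\bar x)=\widehat N(\bar x;\Omega_r)\cap F_+^*.$$
   Context: $X^*$ is the dual of $X$ with pairing $\langle x^*,x\rangle=x^*(x)$. The minimal time function is $$T_\Omega^F(x)=\inf\{t\ge0:(x+tF)\cap\Omega\ne\emptyset\},\quad x\in X,$$ with $\inf\emptyset=\infty$. For $r>0$, $\Omega_r=\{x\in X:T_\Omega^F(x)\le r\}$. (For $\bar x\notin\Omega$ one has $T_\Omega^F(\bar x)>0$.) Also $F_+^*=\{x^*\in X^*:\langle x^*,q\rangle\ge0\text{ for all }q\in F\}$. For a subset $A$ of a normed space and $x\in A$, the Fréchet normal cone is $$\widehat N(x;A)=\Big\{x^*:\limsup_{u\to x,\,u\in A}\frac{\langle x^*,u-x\rangle}{\|u-x\|}\le0\Big\}.$$ For $f\colon X\to(-\infty,\infty]$ and $\bar x$ with $f(\bar x)<\infty$, the Fréchet singular subdifferential is $$\widehat\partial^\infty f(\bar x)=\{x^*\in X^*:(x^*,0)\in\widehat N((\bar x,f(\bar x));\mathrm{epi}(f))\},$$ where $\mathrm{epi}(f)=\{(x,\lambda)\in X\times\mathbb R:\lambda\ge f(x)\}$ and $X\times\mathbb R$ carries the norm $\|(x,\lambda)\|=\|x\|+|\lambda|$ (or any equivalent product norm). *)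

(* Defs.v *)
From HB Require Import structures.
From mathcomp Require Import all_boot all_order all_algebra.
From mathcomp Require Import all_classical all_reals all_analysis.

Set Implicit Arguments.
Unset Strict Implicit.
Unset Printing Implicit Defensive.

Import Order.TTheory GRing.Theory Num.Theory.
Import numFieldTopology.Exports numFieldNormedType.Exports.

Local Open Scope classical_set_scope.
Local Open Scope ring_scope.

Record topdual (R : realType) (X : normedModType R) := Topdual {
  topdual_linear :> {linear X -> R^o};
  topdual_continuous : continuous topdual_linear
}.

Section PairFunctional.
Context (R : realType) (X : normedModType R) (xs : topdual X) (a : R).

Definition pair_functional_fun (z : X * R^o) : R^o := xs z.1 + a * z.2.

Fact pair_functional_linear : linear pair_functional_fun.
Proof.
move=> k u v; rewrite /pair_functional_fun /= linearP mulrDr scalerDr /=.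
by rewrite -!addrA; congr (_ + _); rewrite addrCA; congr (_ + (_ + _)); exact: mulrCA.
Qed.

HB.instance Definition _ := GRing.isLinear.Build R (X * R^o)%type R^o _
  pair_functional_fun pair_functional_linear.

Fact pair_functional_continuous : continuous pair_functional_fun.
Proof.
move=> z; apply: cvgD.
  by apply: continuous_comp; [exact: cvg_fst | exact: topdual_continuous].
by apply: cvgM; [exact: cvg_cst | exact: cvg_snd].
Qed.

(* the element (xs, a) of X^* x R, identified with (X x R)^* *)
Definition pair_functional : topdual (X * R^o)%type :=
  @Topdual R (X * R^o)%type pair_functional_fun pair_functional_continuous.

End PairFunctional.

Section Definitions.
Context (R : realType).

(* The limsup is over punctured neighbourhoods of [x], where the quotient makes
   sense; it is -oo when [x] is isolated in [A]. Only meant for [x] in [A]. *)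
Definition frechet_normal_cone (X : normedModType R) (A : set X) (x : X) :
    set (topdual X) :=
  [set xs | (limf_esup (fun u => (xs (u - x) / `|u - x|)%:E) (within A x^')
             <= 0)%E].

Context (X : normedModType R).

Definition epigraph (f : X -> \bar R) : set (X * R^o) :=
  [set p | (f p.1 <= p.2%:E)%E].

(* Only meant for [f x] finite, so that [fine (f x)] is the value of [f] at
   [x]. The norm of the library on [X * R^o] is the max norm. *)
Definition frechet_singular_subdiff (f : X -> \bar R) (x : X) :
    set (topdual X) :=
  [set xs | frechet_normal_cone (epigraph f) (x, fine (f x))
              (pair_functional xs 0)].

(* [ereal_inf set0 = +oo] *)
Definition minimal_time (F Omega : set X) (x : X) : \bar R :=
  ereal_inf [set t%:E | t in
    [set t : R | 0 <= t /\ [set x + t *: q | q in F] `&` Omega !=set0]].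

Definition time_enlargement (F Omega : set X) (r : R) : set X :=
  [set x | (minimal_time F Omega x <= r%:E)%E].

Definition nonneg_polar (F : set X) : set (topdual X) :=
  [set xs | forall q, F q -> 0 <= xs q].

End Definitions.

(* Main.v *)
Require Import Defs.
From mathcomp Require Import all_boot all_order all_algebra.
From mathcomp Require Import all_classical all_reals all_analysis.
From mathcomp Require Import lra.
Import Order.TTheory GRing.Theory Num.Theory.
Import numFieldTopology.Exports numFieldNormedType.Exports.
Local Open Scope classical_set_scope.
Local Open Scope ring_scope.

(** Write T for the minimal time function. Two facts about T carry the proof,
    and both are statements about moving along a direction q of F.
    Going backward, T (x - t q) <= T x + t: by convexity the displacement
    t q followed by s f, with q and f in F, is (t + s) p for some p in F.
    Going forward, if x + s q lies in Omega with q in F and s > r, then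
    x + (s - r) q lies in the enlargement Omega_r, since r more units of time
    along q lead to Omega.

    A horizontal normal (xs, 0) to the epigraph at (xbar, r) is tested on the
    slice at height r, which is Omega_r and gives the normality of xs to
    Omega_r, and on the points (xbar - t q, r + t) supplied by backward motion,
    where it gives - <xs, q> <= e max(|q|, 1) for every e > 0.

    Conversely, let (x, l) be a point of the epigraph near (xbar, r). If x is
    not in Omega_r, forward motion yields t < 2 (l - r) and q in F with
    y = x + t q in Omega_r. As <xs, q> >= 0, passing from x to y only increases
    <xs, . >, while y - xbar is bounded by a multiple of the norm of
    (x - xbar, l - r) because F is bounded; normality of xs to Omega_r, tested
    on y, then gives the required estimate at (x, l). *)

(** * Estimates characterizing normals and singular subgradients *)

Section Normals.
Context {R : realType}.

(** Multiplying out the quotient makes the base point harmless, so that the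
    estimate can be used without checking that the test point differs
    from it. *)
Lemma frechet_normal_coneP (X : normedModType R) (A : set X) (x : X)
    (xs : topdual X) :
  frechet_normal_cone A x xs <->
  forall e : R, 0 < e -> exists2 d : R, 0 < d &
    forall u, A u -> `|u - x| < d -> xs (u - x) <= e * `|u - x|.
Proof.
split=> [xsN e e0|xsN].
  have /ereal_inf_lt[_ [V VA <-] supV] :
      (limf_esup (fun u => (xs (u - x) / `|u - x|)%:E) (within A x^')
       < e%:E)%E by apply: (le_lt_trans xsN); rewrite lte_fin.
  move: VA; rewrite /within /dnbhs /= => /nbhs_normP[d d0 dV].
  exists d => // u Au ud.
  have [->|ux] := eqVneq u x; first by rewrite subrr linear0 normr0 mulr0.
  have Vu : V u by apply: dV => //=; rewrite distrC.
  rewrite -ler_pdivrMr ?normr_gt0 ?subr_eq0// -lee_fin.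
  by apply: le_trans (ltW supV); apply: ereal_sup_ubound; exists u.
apply/lee_addgt0Pr => e e0; rewrite add0e.
have [d d0 dP] := xsN _ e0.
pose V : set X := [set u | [/\ A u, u != x & `|u - x| < d]].
apply: ge_ereal_inf; exists (ereal_sup
    ((fun u => (xs (u - x) / `|u - x|)%:E) @` V)).
  exists V => //; rewrite /within /dnbhs /=.
  by apply/nbhs_normP; exists d => //= u /= ud ux Au; split=> //; rewrite distrC.
apply: ge_ereal_sup => _ [u [Au ux ud] <-].
by rewrite lee_fin ler_pdivrMr ?normr_gt0 ?subr_eq0// dP.
Qed.

Lemma frechet_singular_subdiffP (X : normedModType R) (f : X -> \bar R)
    (x : X) (r : R) (fx : f x = r%:E) (xs : topdual X) :
  frechet_singular_subdiff f x xs <->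
  forall e : R, 0 < e -> exists2 d : R, 0 < d &
    forall u l, (f u <= l%:E)%E -> `|u - x| < d -> `|l - r| < d ->
      xs (u - x) <= e * Num.max `|u - x| `|l - r|.
Proof.
rewrite /frechet_singular_subdiff /= fx /=.
split=> [/frechet_normal_coneP xsN|xsN].
  move=> e /xsN[d d0 dP]; exists d => // u l ful ud ld.
  have := dP (u, l) ful; rewrite !prod_normE /= gt_max ud ld => /(_ isT).
  by rewrite /pair_functional_fun /= mul0r addr0.
apply/frechet_normal_coneP => e /xsN[d d0 dP]; exists d => // -[u l] ful.
rewrite !prod_normE /= gt_max => /andP[ud ld].
by rewrite /pair_functional_fun /= mul0r addr0; exact: dP.
Qed.

End Normals.

(** * The minimal time function along directions of F *)

Section MinimalTime.
Context {R : realType} {X : normedModType R}.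
Implicit Types (F Omega : set X) (x q : X) (r s t : R).

Lemma minimal_time_le F Omega x q t : 0 <= t -> F q -> Omega (x + t *: q) ->
  (minimal_time F Omega x <= t%:E)%E.
Proof.
move=> t0 Fq Oq; apply: ereal_inf_lbound; exists t => //; split=> //.
by exists (x + t *: q); split=> //; exists q.
Qed.

Lemma minimal_time_lt F Omega x r : (minimal_time F Omega x < r%:E)%E ->
  exists t q, [/\ 0 <= t, t < r, F q & Omega (x + t *: q)].
Proof.
move=> /ereal_inf_lt[_ [t [t0 [_ [[q Fq <-] Oq]]] <-]]; rewrite lte_fin => tr.
by exists t, q.
Qed.

Lemma minimal_time_ge0 F Omega x : (0 <= minimal_time F Omega x)%E.
Proof. by apply: le_ereal_inf_tmp => _ [t [t0 _] <-]; rewrite lee_fin. Qed.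

Lemma convex_set_scale_add F q1 q2 t s : convex_set F -> F q1 -> F q2 ->
  0 < t -> 0 <= s ->
  exists2 q, F q & t *: q1 + s *: q2 = (t + s) *: q.
Proof.
move=> cF Fq1 Fq2 t0 s0.
have ts0 : 0 < t + s by lra.
have k0 : 0 <= t / (t + s) by rewrite divr_ge0// ltW.
have k1 : t / (t + s) <= 1 by rewrite ler_pdivrMr// mul1r lerDl.
have := cF q1 q2 (Itv01 k0 k1); rewrite !inE => /(_ Fq1 Fq2) Fq.
eexists; first exact: Fq.
have tk : (t + s) * (t / (t + s)) = t by rewrite mulrC divfK// gt_eqF.
rewrite /conv /= scalerDr !scalerA /unstable.onem mulrBr mulr1 tk.
by rewrite [t + s - t]addrC addKr.
Qed.

Lemma minimal_time_backward F Omega x q r t : convex_set F -> F q -> 0 < t ->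
  (minimal_time F Omega x <= r%:E)%E ->
  (minimal_time F Omega (x - t *: q)%R <= (r + t)%R%:E)%E.
Proof.
move=> cF Fq t0 Tr; apply/lee_addgt0Pr => e e0; rewrite -EFinD.
have : (minimal_time F Omega x < (r + e)%R%:E)%E.
  by apply: (le_lt_trans Tr); rewrite lte_fin ltrDl.
move=> /minimal_time_lt[s [f [s0 sr Ff Of]]].
have [p Fp pE] := convex_set_scale_add _ _ _ _ _ cF Fq Ff t0 s0.
apply: (@le_trans _ _ (t + s)%:E); last by rewrite lee_fin; lra.
apply: (@minimal_time_le _ _ _ p) => //; first lra.
by rewrite -pE addrA subrK.
Qed.

(** A trajectory reaching Omega at time s > r is in Omega_r at time s - r. When
    s <= r the point already lies in Omega_r, and s - r would be a negative
    time, hence the two cases. *)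
Lemma minimal_time_forward F Omega x r l :
  0 <= r -> (minimal_time F Omega x < l%:E)%E ->
  time_enlargement F Omega r x \/
  exists t q, [/\ 0 <= t, t < l - r, F q
                & time_enlargement F Omega r (x + t *: q)].
Proof.
move=> r0 /minimal_time_lt[s [q [s0 sl Fq Oq]]].
have [sr|rs] := leP s r.
  left; rewrite /time_enlargement /=.
  by apply: (@le_trans _ _ s%:E); [exact: minimal_time_le Oq|rewrite lee_fin].
right; exists (s - r), q; split => //; [lra|lra|].
apply: (@minimal_time_le _ _ _ q) => //.
by rewrite -addrA -scalerDl subrK.
Qed.

End MinimalTime.

(** * The two inclusions *)

Section SingularSubdifferential.
Context {R : realType} {X : normedModType R}.
Context (F Omega : set X) (xbar : X) (r : R)
  (r_def : minimal_time F Omega xbar = r%:E).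
Implicit Type xs : topdual X.

Lemma singular_subdiff_normal xs :
  frechet_singular_subdiff (minimal_time F Omega) xbar xs ->
  frechet_normal_cone (time_enlargement F Omega r) xbar xs.
Proof.
move=> /(frechet_singular_subdiffP _ _ _ _ r_def) xsS.
apply/frechet_normal_coneP => e /xsS[d d0 dP]; exists d => // u Tu ud.
have := dP u r Tu ud; rewrite subrr normr0 => /(_ d0).
by rewrite max_l.
Qed.

Lemma singular_subdiff_polar xs : convex_set F ->
  frechet_singular_subdiff (minimal_time F Omega) xbar xs ->
  nonneg_polar F xs.
Proof.
move=> cF /(frechet_singular_subdiffP _ _ _ _ r_def) xsS q Fq.
set m : R := Num.max `|q| 1.
have qm : `|q| <= m by rewrite /m le_max lexx.
have m1 : 1 <= m by rewrite /m le_max lexx orbT.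
have m0 : 0 < m by lra.
rewrite -oppr_le0; apply/ler_addgt0Pr => e e0; rewrite add0r.
have em0 : 0 < e / m by rewrite divr_gt0.
have [d d0 dP] := xsS _ em0.
pose t := d / (2 * m).
have t0 : 0 < t by rewrite divr_gt0// mulr_gt0.
have tm : t * m = d / 2 by rewrite /t invfM mulrA divfK// gt_eqF.
have tm_d : t * m < d by rewrite tm; lra.
have /dP : (minimal_time F Omega (xbar - t *: q)%R <= (r + t)%R%:E)%E.
  by apply: minimal_time_backward => //; rewrite r_def.
have -> : xbar - t *: q - xbar = - t *: q by rewrite addrAC subrr add0r scaleNr.
have -> : r + t - r = t by lra.
rewrite normrZ normrN (gtr0_norm t0) => dPq.
have tq : t * `|q| <= t * m by rewrite ler_pM2l.
have t_tm : t <= t * m by rewrite ler_peMr// ltW.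
have {dPq} := dPq (le_lt_trans tq tm_d) (le_lt_trans t_tm tm_d).
rewrite linearZ /= => H.
have : t * - xs q <= t * e.
  have -> : t * - xs q = - t *: xs q by rewrite mulrN -mulNr.
  apply: (le_trans H).
  have -> : t * e = e / m * (t * m) by rewrite mulrCA divfK// gt_eqF.
  by rewrite ler_pM2l// ge_max tq.
by rewrite ler_pM2l.
Qed.

Lemma normal_polar_singular_subdiff xs : bounded_set F ->
  frechet_normal_cone (time_enlargement F Omega r) xbar xs ->
  nonneg_polar F xs ->
  frechet_singular_subdiff (minimal_time F Omega) xbar xs.
Proof.
move=> /pinfty_ex_gt0[M M0 FM] /frechet_normal_coneP xsN xsF.
have r0 : 0 <= r by rewrite -lee_fin -r_def minimal_time_ge0.
apply/(frechet_singular_subdiffP _ _ _ _ r_def) => e e0.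
(* The constant bounds |y - xbar| <= |x - xbar| + 2 (l - r) M. *)
set c := 1 + 2 * M.
have c0 : 0 < c by rewrite /c; lra.
have ec0 : 0 < e / c by rewrite divr_gt0.
have [d d0 dP] := xsN _ ec0.
exists (d / c); first by rewrite divr_gt0.
move=> x l Tx xd ld; set n := Num.max _ _.
have xn : `|x - xbar| <= n by rewrite /n le_max lexx.
have ln : `|l - r| <= n by rewrite /n le_max lexx orbT.
have n0 : 0 <= n by apply: le_trans xn.
have cn_d : c * n < d by rewrite mulrC -ltr_pdivlMr// /n gt_max xd ld.
have near y : time_enlargement F Omega r y -> xs x <= xs y ->
    `|y - xbar| <= c * n -> xs (x - xbar) <= e * n.
  move=> Ty xy yn; apply: (@le_trans _ _ (xs (y - xbar))).
    by rewrite !linearB /= lerB.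
  apply: (le_trans (dP _ Ty (le_lt_trans yn cn_d))).
  have -> : e * n = e / c * (c * n) by rewrite mulrA divfK// gt_eqF.
  by rewrite ler_pM2l.
have stay : time_enlargement F Omega r x -> xs (x - xbar) <= e * n.
  move=> Ox; apply: (near x) => //; apply: (le_trans xn).
  by rewrite ler_peMl// /c; lra.
have [lr|rl] := leP l r.
  by apply: stay; apply: (le_trans Tx); rewrite lee_fin.
(* T x may fail to be attained: aim at time l + (l - r) instead of l. *)
have : (minimal_time F Omega x < (l + (l - r))%R%:E)%E.
  by apply: (le_lt_trans Tx); rewrite lte_fin; lra.
move=> /(minimal_time_forward _ _ _ _ _ r0)[|[t [q [t0 tl Fq Oq]]]].
  exact: stay.
apply: (near _ Oq).
  by rewrite linearD linearZ /= lerDl mulr_ge0// xsF.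
have -> : x + t *: q - xbar = (x - xbar) + t *: q by rewrite addrAC.
apply: (le_trans (ler_normD _ _)).
rewrite normrZ (ger0_norm t0) /c mulrDl mul1r lerD//.
have qM : `|q| <= M by exact: FM.
have t2n : t <= 2 * n.
  by apply: (@le_trans _ _ (2 * (l - r))); [lra|have := ler_norm (l - r); lra].
by rewrite mulrAC ler_pM.
Qed.

End SingularSubdifferential.

Theorem theorem4p3 (R : realType) (X : normedModType R) (Omega F : set X)
  (Omega0 : Omega !=set0) (Omega_closed : closed Omega)
  (F0 : F !=set0) (F_closed : closed F) (F_bounded : bounded_set F)
  (F_convex : convex_set F) (F_neq : F <> [set 0])
  (xbar : X) (xbar_notin : ~ Omega xbar)
  (r : R) (r_def : minimal_time F Omega xbar = r%:E) :
  frechet_singular_subdiff (minimal_time F Omega) xbar =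
  frechet_normal_cone (time_enlargement F Omega r) xbar `&` nonneg_polar F.
Proof.
apply/seteqP; split=> [xs xsS|xs [xsN xsF]].
  split; first exact: singular_subdiff_normal r_def _ xsS.
  exact: singular_subdiff_polar r_def _ F_convex xsS.
exact: normal_polar_singular_subdiff r_def _ F_bounded xsN xsF.
Qed.
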